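(* Let $F$ be a field of characteristic not two and let $E$ be a finite-dimensional vector space over $F$ with an arbitrary symmetric bilinear form $(U,V)\mapsto U\cdot V$. If $u=[U]$, $v=[V]$ and $w=[W]$ are collinear non-null projective points of $E$, then the projective quadrances $q_w=q(u,v)$, $q_u=q(v,w)$ and $q_v=q(u,w)$ satisfy $$(q_u+q_v+q_w)^2=2\left(q_u^2+q_v^2+q_w^2\right)+4q_uq_vq_w.$$
   Context: A projective point $u=[U]$ is a one-dimensional subspace of $E$, spanned by a non-zero vector $U$. It is null if $U\cdot U=0$, and non-null otherwise. Projective points are collinear when they are all contained in a single two-dimensional subspace of $E$ (a projective line). The projective quadrance between non-null projective points $u=[U]$ and $v=[V]$ is $$q(u,v)=1-\frac{(U\cdot V)^2}{(U\cdot U)(V\cdot V)},$$ independent of the choice of spanning vectors. The bilinear form is not assumed non-degenerate. *)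

(* Defs.v *)
From mathcomp Require Import all_boot all_order all_algebra.

Set Implicit Arguments.
Unset Strict Implicit.
Unset Printing Implicit Defensive.

Import GRing.Theory.
Local Open Scope ring_scope.

Record proj_point (F : fieldType) (E : vectType F) := ProjPoint {
  point_space :> {vspace E};
  dim_point : \dim point_space = 1
}.

(* A vector U with u = [U]; which one is irrelevant for the notions below, see *)
(* nullE and quadranceE.                                                       *)
Definition spanning (F : fieldType) (E : vectType F) (u : proj_point E) : E :=
  vpick u.

Definition null (F : fieldType) (E : vectType F) (dot : {symmetric E})
    (u : proj_point E) : bool :=
  dot (spanning u) (spanning u) == 0.

(* As x / 0 = 0 in MathComp, this is total, but it is only meaningful when u   *)
(* and v are non-null.                                                         *)
Definition quadrance (F : fieldType) (E : vectType F) (dot : {symmetric E})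
    (u v : proj_point E) : F :=
  let U := spanning u in let V := spanning v in
  1 - dot U V ^+ 2 / (dot U U * dot V V).

Definition collinear (F : fieldType) (E : vectType F)
    (s : seq (proj_point E)) : Prop :=
  exists2 L : {vspace E}, \dim L = 2 & all (fun u : proj_point E => u <= L)%VS s.

Lemma spanningP (F : fieldType) (E : vectType F) (u : proj_point E) :
  spanning u != 0 /\ point_space u = <[spanning u]>%VS.
Proof.
have nz : spanning u != 0 by rewrite vpick0 -dimv_eq0 dim_point.
split=> //; apply/esym/eqP; rewrite eqEdim dim_vline nz dim_point leqnn andbT.
by rewrite -memvE memv_pick.
Qed.

Lemma spanning_scale (F : fieldType) (E : vectType F) (u : proj_point E)
    (U : E) :
  point_space u = <[U]>%VS -> exists2 c : F, c != 0 & spanning u = c *: U.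
Proof.
move=> uU; have [nz _] := spanningP u.
have /vlineP[c sc] : spanning u \in <[U]>%VS by rewrite -uU memv_pick.
by exists c => //; apply: contraNneq nz => c0; rewrite sc c0 scale0r.
Qed.

Lemma dotZZ (F : fieldType) (E : vectType F) (dot : {symmetric E})
    (a b : F) (U V : E) : dot (a *: U) (b *: V) = a * b * dot U V.
Proof. by rewrite linearZl_LR linearZr_LR /= mulrA. Qed.

Lemma nullE (F : fieldType) (E : vectType F) (dot : {symmetric E})
    (u : proj_point E) (U : E) :
  point_space u = <[U]>%VS -> null dot u = (dot U U == 0).
Proof.
move=> /spanning_scale[c c0 sc].
by rewrite /null sc dotZZ !mulf_eq0 (negPf c0).
Qed.

Lemma quadranceE (F : fieldType) (E : vectType F) (dot : {symmetric E})
    (u v : proj_point E) (U V : E) :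
    point_space u = <[U]>%VS -> point_space v = <[V]>%VS ->
  quadrance dot u v = 1 - dot U V ^+ 2 / (dot U U * dot V V).
Proof.
move=> /spanning_scale[a a0 su] /spanning_scale[b b0 sv].
have ab0 : (a * b) ^+ 2 != 0 by rewrite expf_neq0 // mulf_neq0.
rewrite /quadrance su sv !dotZZ exprMn [a * a * _ * _]mulrACA.
by rewrite [a * a * _]mulrACA -expr2 -mulf_div divff // mul1r.
Qed.

(* Main.v *)
Require Import Defs.
From mathcomp Require Import all_boot all_order all_algebra.
From mathcomp Require Import ring.
Import GRing.Theory.
Local Open Scope ring_scope.

(** Three vectors U, V, W in a plane are linearly dependent, and applying the
form to a dependency shows that the rows of their Gram matrix satisfy the same
dependency; so the Gram determinant vanishes ([gram_det_eq0]), whether or not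
the form is degenerate.  Divided by (U.U)(V.V)(W.W), this says
<<
  1 - x - y - z + 2 t = 0
>>
where x = 1 - q_w, y = 1 - q_v, z = 1 - q_u are the squared cosines and t is
(U.V)(U.W)(V.W) / ((U.U)(V.V)(W.W)).  As t^2 = x y z, eliminating t gives
(x + y + z - 1)^2 = 4 x y z, an equation in the quadrances alone, and in terms
of the quadrances it is the formula to be proved ([triple_quad_cos2]). *)

Definition gram {F : fieldType} {E : vectType F} (dot : {symmetric E})
    {n : nat} (X : n.-tuple E) : 'M[F]_n :=
  \matrix_(i, j) dot X`_i X`_j.

Lemma gram_det_eq0 (F : fieldType) (E : vectType F) (dot : {symmetric E})
    (n : nat) (X : n.-tuple E) :
  ~~ free X -> \det (gram dot X) = 0.
Proof.
move=> nfreeX; apply/eqP; apply: contraNT nfreeX => det_n0.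
apply/freeP => k kX0 i; apply: contraNeq det_n0 => ki_n0.
(* The coefficients of a dependency form a row killed by the Gram matrix. *)
apply/det0P; exists (\row_j k j).
  by apply: contraNneq ki_n0 => /rowP/(_ i); rewrite !mxE => ->.
apply/rowP => j; rewrite !mxE.
transitivity (dot (\sum_(l < n) k l *: X`_l) X`_j); last first.
  by rewrite kX0 linear0l.
by rewrite linear_sumlz; apply: eq_bigr => l _; rewrite !mxE linearZl_LR.
Qed.

Lemma det_mx33 (R : comPzRingType) (A : 'M[R]_3) :
  \det A = A 0 0 * (A 1 1 * A 2%:R 2%:R - A 1 2%:R * A 2%:R 1)
         - A 0 1 * (A 1 0 * A 2%:R 2%:R - A 1 2%:R * A 2%:R 0)
         + A 0 2%:R * (A 1 0 * A 2%:R 1 - A 1 1 * A 2%:R 0).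
Proof.
(* Reading the entries at natural-number indices makes the nested lifts coming
   from the two Laplace expansions evaluate to numerals. *)
pose B (i j : nat) := A (inord i) (inord j).
have AE i j : A i j = B i j by rewrite /B !inord_val.
rewrite (expand_det_row _ 0) !big_ord_recl big_ord0 /cofactor.
rewrite !(expand_det_row _ 0) !big_ord_recl !big_ord0 /cofactor !det_mx11 !mxE.
by rewrite !AE /= /bump /=; ring.
Qed.

Lemma gram_det3 (F : fieldType) (E : vectType F) (dot : {symmetric E})
    (U V W : E) :
  \det (gram dot [tuple U; V; W]) =
    dot U U * dot V V * dot W W + 2%:R * dot U V * dot U W * dot V W
    - dot U U * dot V W ^+ 2 - dot V V * dot U W ^+ 2 - dot W W * dot U V ^+ 2.
Proof.
have dotC X Y : dot X Y = dot Y X by rewrite hermC expr0 mul1r.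
rewrite det_mx33 !mxE /= (dotC V U) (dotC W U) (dotC W V).
ring.
Qed.

Lemma collinear_not_free (F : fieldType) (E : vectType F)
    (s : seq (proj_point E)) :
  collinear s -> (2 < size s)%N -> ~~ free (map (@spanning F E) s).
Proof.
case=> L dimL sL; apply: contraTN => free_s.
have sub_sL : (<<map (@spanning F E) s>> <= L)%VS.
  (* Points have no decidable equality, so membership in s is not available. *)
  elim: s sL {free_s} => [|p s IHs] /=; first by rewrite span_nil sub0v.
  case/andP=> pL sL; rewrite span_cons subv_add IHs // andbT -memvE.
  by apply: (subvP pL); apply: memv_pick.
move: free_s (dimvS sub_sL); rewrite dimL -leqNgt /free size_map => /eqP -> //.
Qed.

(** With x, y, z the squared cosines of three vectors, the hypothesis is what the
vanishing of their normalized Gram determinant becomes once the product of the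
three cosines has been eliminated by squaring. *)
Lemma triple_quad_cos2 (R : comPzRingType) (x y z : R) :
    (x + y + z - 1) ^+ 2 = 4%:R * x * y * z ->
  ((1 - z) + (1 - y) + (1 - x)) ^+ 2 =
    2%:R * ((1 - z) ^+ 2 + (1 - y) ^+ 2 + (1 - x) ^+ 2)
    + 4%:R * (1 - z) * (1 - y) * (1 - x).
Proof.
(* Both sides differ by the difference of the sides of the hypothesis. *)
move=> xyz; apply/eqP; rewrite -subr_eq0; apply/eqP.
transitivity (4%:R * x * y * z - (x + y + z - 1) ^+ 2); first by ring.
by rewrite xyz subrr.
Qed.

Theorem theorem7 (F : fieldType) (char_neq2 : 2%N \notin [pchar F])
    (E : vectType F) (dot : {symmetric E}) (u v w : proj_point E)
    (u_nonnull : ~~ null dot u) (v_nonnull : ~~ null dot v)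
    (w_nonnull : ~~ null dot w) (uvw_collinear : collinear [:: u; v; w]) :
  let q_w := quadrance dot u v in
  let q_u := quadrance dot v w in
  let q_v := quadrance dot u w in
  (q_u + q_v + q_w) ^+ 2 =
    2%:R * (q_u ^+ 2 + q_v ^+ 2 + q_w ^+ 2) + 4%:R * q_u * q_v * q_w.
Proof.
move=> q_w q_u q_v; rewrite /q_w /q_u /q_v /quadrance /=.
have := gram_det_eq0 F E dot 3 [tuple spanning u; spanning v; spanning w]
  (collinear_not_free F E _ uvw_collinear isT).
rewrite gram_det3; move: u_nonnull v_nonnull w_nonnull; rewrite /null.
set a := dot (spanning u) _; set b := dot (spanning v) _.
set c := dot (spanning w) _; set d := dot (spanning u) (spanning v).
set e := dot (spanning u) (spanning w); set f := dot (spanning v) _.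
move=> a0 b0 c0 gram0; apply: triple_quad_cos2.
set t := d * e * f / (a * b * c).
have -> : d ^+ 2 / (a * b) + e ^+ 2 / (a * c) + f ^+ 2 / (b * c) - 1 = 2%:R * t.
  apply/eqP; rewrite -subr_eq0; apply/eqP.
  transitivity (- (a * b * c + 2%:R * d * e * f - a * f ^+ 2 - b * e ^+ 2
                   - c * d ^+ 2) / (a * b * c)).
    by rewrite /t; field; rewrite a0 b0 c0.
  by rewrite gram0 oppr0 mul0r.
by rewrite /t; field; rewrite a0 b0 c0.
Qed.
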